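(* Let $\Gamma=(X,R)$ be a connected graph (not necessarily regular) on $n=|X|$ vertices, with Laplacian matrix $L$ having distinct eigenvalues $\theta_0=0<\theta_1<\cdots<\theta_d$ with respective multiplicities $m(\theta_i)$, diameter $D$, and Laplacian predistance polynomials $r_0,\ldots,r_d$. Let $\psi_i=\prod_{j\neq i}(\theta_i-\theta_j)$ for $i=0,\ldots,d$, and let $s_{d-1}=r_0+\cdots+r_{d-1}$. Then $\Gamma$ is distance-regular if and only if $D=d$ and $$ \frac{|X|}{\sum_{x\in X}\frac{1}{|X|-|\Gamma_d(x)|}}=s_{d-1}(0)=|X|-r_d(0)=n\left[1-\left(\sum_{i=0}^d\frac{\psi_0^2}{m(\theta_i)\psi_i^2}\right)^{-1}\right]. $$
   Context: Graphs are finite, simple, undirected, connected, with vertex set $X$, $n=|X|\ge 2$. For $x\in X$, $\Gamma_i(x)$ is the set of vertices at distance exactly $i$ from $x$. A connected graph is distance-regular if for all $h,i,j$ the number of vertices $z$ at distance $i$ from $x$ and $j$ from $y$ depends only on $h,i,j$ whenever $x,y$ are at distance $h$ (in particular, such a graph is regular). The Laplacian matrix is $L=K-A$, where $A$ is the adjacency matrix and $K$ is the diagonal matrix of vertex degrees. On the real polynomials of degree at most $d$ consider the scalar product $$\langle f,g\rangle_L=\frac1n\operatorname{tr}(f(L)g(L))=\frac1n\sum_{i=0}^d m(\theta_i)f(\theta_i)g(\theta_i).$$ The Laplacian predistance polynomials $r_0,\ldots,r_d$ are the unique sequence of polynomials with $\deg r_i=i$, pairwise orthogonal for $\langle\cdot,\cdot\rangle_L$,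 normalized so that $\|r_i\|_L^2=\langle r_i,r_i\rangle_L=r_i(0)$. *)

(* Defs.v *)
From HB Require Import structures.
From mathcomp Require Import all_boot all_order all_algebra.

Set Implicit Arguments.
Unset Strict Implicit.
Unset Printing Implicit Defensive.

Import Order.TTheory GRing.Theory Num.Theory.

Local Open Scope ring_scope.

Definition simple_graph (X : finType) (e : rel X) : Prop :=
  symmetric e /\ irreflexive e.

Definition connected_graph (X : finType) (e : rel X) : Prop :=
  forall x y : X, connect e x y.

Definition walk_of_length (X : finType) (e : rel X) (x y : X) (k : nat) : bool :=
  [exists p : k.-tuple X, path e x p && (last x p == y)].

(* Shortest walks have length < #|X|; the value #|X| is returned exactly when *)
(* y is not reachable from x.                                                 *)
Definition dist (X : finType) (e : rel X) (x y : X) : nat :=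
  find (walk_of_length e x y) (iota 0 #|X|).

Definition diameter (X : finType) (e : rel X) : nat :=
  \max_(x : X) \max_(y : X) dist e x y.

Definition sphere (X : finType) (e : rel X) (i : nat) (x : X) : {set X} :=
  [set y | dist e x y == i].

Definition distance_regular (X : finType) (e : rel X) : Prop :=
  exists p : nat -> nat -> nat -> nat,
    forall (h i j : nat) (x y : X), dist e x y = h ->
      #|sphere e i x :&: sphere e j y| = p h i j.

Section Laplacian.
Variables (R : rcfType) (X : finType) (e : rel X).

Definition adjacency : 'M[R]_#|X| :=
  \matrix_(i, j) (e (enum_val i) (enum_val j))%:R.

Definition degree_mx : 'M[R]_#|X| :=
  diag_mx (\row_i #|[set y | e (enum_val i) y]|%:R).

Definition laplacian : 'M[R]_#|X| := degree_mx - adjacency.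

Definition laplacian_spectrum (d : nat) (theta : 'I_d.+1 -> R) : Prop :=
  [/\ theta ord0 = 0,
      forall i j : 'I_d.+1, (i < j)%N -> theta i < theta j
    & forall a : R, eigenvalue laplacian a <-> exists i, a = theta i].

Definition multiplicity (a : R) : nat := \rank (eigenspace laplacian a).

End Laplacian.

(* horner_mx is only typed at sizes of the form n.+1, whereas #|X| is not     *)
(* syntactically a successor; see mx_hornerE.                                 *)
Definition mx_horner (R : comNzRingType) (n : nat) (A : 'M[R]_n)
    (p : {poly R}) : 'M[R]_n :=
  \sum_(i < size p) p`_i *: A ^+ i.

Lemma mx_hornerE (R : comNzRingType) (n : nat) (A : 'M[R]_n.+1) (p : {poly R}) :
  mx_horner A p = horner_mx A p.
Proof.
rewrite -[in RHS](coefK p) poly_def rmorph_sum /=; apply: eq_bigr => i _.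
by rewrite linearZ /= rmorphXn /= horner_mx_X.
Qed.

Section Predistance.
Variables (R : rcfType) (X : finType) (e : rel X).

Definition laplacian_dot (f g : {poly R}) : R :=
  #|X|%:R^-1 *
    \tr (mx_horner (laplacian R e) f *m mx_horner (laplacian R e) g).

Definition laplacian_predistance (d : nat) (r : 'I_d.+1 -> {poly R}) : Prop :=
  [/\ forall i : 'I_d.+1, size (r i) = i.+1,
      forall i j : 'I_d.+1, i != j -> laplacian_dot (r i) (r j) = 0
    & forall i : 'I_d.+1, laplacian_dot (r i) (r i) = (r i).[0]].

End Predistance.

Definition spectral_psi (R : rcfType) (d : nat) (theta : 'I_d.+1 -> R)
    (i : 'I_d.+1) : R :=
  \prod_(j < d.+1 | j != i) (theta i - theta j).

(* Main.v *)
Require Import Defs.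
From HB Require Import structures.
From mathcomp Require Import all_boot all_order all_algebra.
From mathcomp Require Import complex ring.

Set Implicit Arguments.
Unset Strict Implicit.
Unset Printing Implicit Defensive.

Import Order.TTheory GRing.Theory Num.Theory.

Local Open Scope ring_scope.

(** Write R_k = r_k(L), A_k for the matrix of the pairs at distance k, and J for
    the all-ones matrix. The graph enters through three facts about its
    Laplacian: L is a real symmetric matrix, its kernel is spanned by the
    constant vector ([laplacian_ker]), and a polynomial of degree less than
    dist x y in L has a zero entry at (x, y) ([laplacian_poly_local]).

    As L is symmetric, f(L) depends only on the values of f on the spectrum, and
    the R_k form an orthogonal basis of the algebra of polynomials in L
    ([predistance_expansion]). The projection onto the kernel is J / n, so J lies
    in this algebra, and the normalisation of the r_k gives R_0 + ... + R_d = J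
    ([hoffman]). Row sums then yield s(0) = n - r_d(0) for s = r_0 + ... +
    r_{d-1}. Orthogonality of r_d to the lower degrees determines its values on
    the spectrum up to a factor, which the normalisation fixes; this is the
    formula for r_d(0) ([predistance_top0]). Both identities hold in every
    connected graph, and distance-regularity is measured by the first equality.

    For that one, the matrix S = s(L) has all row sums equal to s(0), the sum of
    the squares of its entries is n s(0), and its entries at distance d are zero.
    The Cauchy-Schwarz inequality in the row of x, which has n - |sphere d x|
    remaining positions, and summation over x bound s(0) from above by the
    harmonic mean in the statement. Equality forces S to be constant on the
    remaining positions of each row; symmetry and connectedness make the
    constants equal, and the sum of squares makes them 1. So S = J - A_d, that
    is R_d = A_d ([predistance_top_dist_mx]). The three-term recurrence of the
    r_k carries this down to R_k = A_k for all k ([predistance_dist_mx]). Then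
    A_a A_b is a combination of the A_k, which is distance-regularity
    ([distance_regular_of_dist_mx]).

    Conversely, in a distance-regular graph the span of the A_k with k <= d is
    stable under L and contains the d+1 independent powers L^0, ..., L^d. The
    two spans are therefore equal: no A_k vanishes, so the diameter is d
    ([regular_diameter]), and A_d is a polynomial in L. By locality it is
    orthogonal to r_0, ..., r_{d-1}, so it is a multiple of R_d, and comparing
    norms and row sums gives A_d = R_d and |sphere d x| = r_d(0) for all x
    ([sphere_top_card]). The harmonic mean of the equal numbers n - r_d(0) is
    n - r_d(0) = s(0). *)

(** * Polynomials, ranks and traces of matrices *)

Lemma row_free_row_neq0 (F : fieldType) m n (M : 'M[F]_(m, n)) i :
  row_free M -> row i M != 0.
Proof.
move/row_free_inj=> M_inj; apply/eqP; rewrite rowE -(mul0mx 1 M).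
by move/M_inj/rowP/(_ i)/eqP; rewrite !mxE !eqxx oner_eq0.
Qed.

Lemma size_sub_lead (F : fieldType) m (f g : {poly F}) :
  (size f <= m.+1)%N -> size g = m.+1 ->
  (size (f - (f`_m / g`_m) *: g)%R <= m)%N.
Proof.
move=> size_f size_g; have gm_neq0 : g`_m != 0.
  rewrite -[m]/(m.+1.-1) -[X in X.-1]size_g -lead_coefE.
  by rewrite lead_coef_eq0 -size_poly_eq0 size_g.
apply/leq_sizeP=> k; rewrite leq_eqVlt coefB coefZ => /predU1P[<-|mk].
  by rewrite divfK ?subrr.
rewrite [f`_k]nth_default; last exact: leq_trans mk.
by rewrite [g`_k]nth_default ?mulr0 ?subr0 // size_g.
Qed.

Lemma big_ord_lt_last (V : nmodType) d (F : 'I_d.+1 -> V) :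
  \sum_k F k = \sum_(k < d.+1 | (k < d)%N) F k + F ord_max.
Proof.
rewrite (bigD1 ord_max) //= addrC; congr (_ + _); apply: eq_bigl => k.
by rewrite -val_eqE /= ltn_neqAle -ltnS ltn_ord andbT.
Qed.

Section Horner.
Variables (R : comNzRingType) (n : nat) (A : 'M[R]_n).

(** In positive dimension [mx_horner] is [horner_mx], and in dimension 0 all
    matrices are equal. Declaring it a linear ring morphism makes the generic
    rewriting rules available in every dimension. *)
Lemma mx_horner_is_linear : linear (mx_horner A).
Proof.
case: n A => [|m] B a p q; first by rewrite [LHS]flatmx0 [RHS]flatmx0.
by rewrite !mx_hornerE linearP.
Qed.

HB.instance Definition _ :=
  GRing.isLinear.Build R {poly R} 'M[R]_n _ (mx_horner A) mx_horner_is_linear.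

(** Rewriting with the generic [linearZ] is ambiguous here, because [mx_horner
    A p] is itself a sum of scaled matrices. *)
Lemma mx_hornerZ a p : mx_horner A (a *: p) = a *: mx_horner A p.
Proof. exact: linearZ. Qed.

Lemma mx_horner_is_monoid_morphism : monoid_morphism (mx_horner A).
Proof.
split=> [|p q]; case: n A => [|m] B;
  rewrite ?(flatmx0 (mx_horner _ _)) ?mx_hornerE.
- by rewrite flatmx0.
- by rewrite rmorph1.
- by rewrite [RHS]flatmx0.
- by rewrite rmorphM.
Qed.

HB.instance Definition _ :=
  GRing.isMonoidMorphism.Build {poly R} 'M[R]_n (mx_horner A)
    mx_horner_is_monoid_morphism.

Lemma mx_hornerX : mx_horner A 'X = A.
Proof.
rewrite /mx_horner size_polyX big_ord_recl big_ord1 !coefX.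
by rewrite scale0r add0r scale1r expr1.
Qed.

Lemma mx_hornerC c : mx_horner A c%:P = c%:M.
Proof.
by rewrite -[c%:P]mulr1 mul_polyC linearZ /= rmorph1 scale_scalar_mx mulr1.
Qed.

Lemma mx_horner_trmx p : A^T = A -> (mx_horner A p)^T = mx_horner A p.
Proof.
move=> AT.
have XT k : (A ^+ k)^T = A ^+ k.
  by elim: k => [|k IH]; rewrite ?trmx1 // [in LHS]exprS trmx_mul IH AT exprSr.
by rewrite linear_sum; apply: eq_bigr => i _; rewrite linearZ /= XT.
Qed.

Lemma mx_horner_eigenvector p (v : 'rV_n) a :
  v *m A = a *: v -> v *m mx_horner A p = p.[a] *: v.
Proof.
move=> vA; have vAX k : v *m A ^+ k = a ^+ k *: v.
  elim: k => [|k IH]; first by rewrite expr0 scale1r mulmx1.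
  by rewrite exprSr mulmxA IH -scalemxAl vA scalerA exprSr.
rewrite mulmx_sumr horner_coef scaler_suml; apply: eq_bigr => i _.
by rewrite -scalemxAr vAX scalerA.
Qed.

End Horner.

(** In a full rank factorisation E = c r of an idempotent, cancelling c and r
    in c r c r = c r gives r c = 1, and the trace of c r is that of r c. *)
Lemma mxtrace_idempotent (F : fieldType) n (E : 'M[F]_n) :
  E *m E = E -> \tr E = (\rank E)%:R.
Proof.
move=> EE; have := row_full_inj (col_base_full E).
have := row_free_inj (row_base_free E).
move: (mulmx_base E); move: (col_base E) (row_base E) => c r crE r_inj c_inj.
rewrite -[in LHS]crE mxtrace_mulC; suff -> : r *m c = 1%:M by rewrite mxtrace1.
by apply: r_inj; apply: c_inj; rewrite mul1mx !mulmxA crE -mulmxA crE EE.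
Qed.

Lemma sum_sqr_mx_eq0 (R : realDomainType) m n (M : 'M[R]_(m, n)) :
  \sum_i \sum_j M i j ^+ 2 = 0 -> M = 0.
Proof.
move=> sum0; apply/matrixP=> i j.
have row_ge0 k : true -> 0 <= \sum_j M k j ^+ 2.
  by move=> _; apply: sumr_ge0 => *; apply: sqr_ge0.
have row0 := psumr_eq0P row_ge0 sum0 (i := i) isT.
have /eqP := psumr_eq0P (fun j _ => sqr_ge0 _) row0 (i := j) isT.
by rewrite sqrf_eq0 mxE => /eqP.
Qed.

Section SymmetricReal.
Variables (R : rcfType) (n : nat) (A : 'M[R]_n).
Hypothesis AT : A^T = A.

Lemma mxtrace_sqr_symmetric (M : 'M[R]_n) : M^T = M ->
  \tr (M *m M) = \sum_i \sum_j M i j ^+ 2.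
Proof.
move=> MT; apply: eq_bigr => i _; rewrite mxE; apply: eq_bigr => j _.
by rewrite -{2}MT mxE expr2.
Qed.

Lemma mxtrace_sqr_eq0 (M : 'M[R]_n) : M^T = M -> \tr (M *m M) = 0 -> M = 0.
Proof. by move=> MT; rewrite mxtrace_sqr_symmetric //; apply: sum_sqr_mx_eq0. Qed.

(** Over the complex extension A has a basis of eigenvectors with real
    eigenvalues. Being an eigenvalue is a rank condition, which does not
    depend on the field, so each of these is some [theta i] and the product
    kills its eigenvectors. *)
Lemma symmetric_annihilated (I : finType) (theta : I -> R) :
  (forall a, eigenvalue A a -> exists i, a = theta i) ->
  mx_horner A (\prod_i ('X - (theta i)%:P)) = 0.
Proof.
move=> A_theta; set q := \prod_i _; set f := real_complex R.
have map_mxX k : map_mx f (A ^+ k) = (map_mx f A) ^+ k.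
  by elim: k => [|k IH]; rewrite ?map_mx1 // !exprS map_mxM IH.
pose B := map_mx f A.
have mapE : map_mx f (mx_horner A q) = mx_horner B (map_poly f q).
  rewrite /mx_horner size_map_poly raddf_sum; apply: eq_bigr => i _ /=.
  by rewrite map_mxZ map_mxX coef_map.
have Bherm : B \is hermsymmx.
  apply: realsym_hermsym; last first.
    by apply/mxOverP=> i j; rewrite mxE; apply/complex_realP; exists (A i j).
  apply/is_hermitianmxP; rewrite expr0 scale1r; apply/matrixP=> i j.
  by rewrite !mxE -[in LHS]AT mxE.
have /orthomx_spectralP Bdiag := hermitian_normalmx Bherm.
have sp_real := hermitian_spectral_diag_real Bherm.
set P := spectralmx B in Bdiag; set sp := spectral_diag B in Bdiag sp_real.
have Pu : P \in unitmx := spectral_unit B.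
have PB i : row i P *m B = sp 0 i *: row i P.
  rewrite -row_mul {1}Bdiag !mulmxA mulmxV // mul1mx row_mul row_diag_mx.
  by rewrite -scalemxAl -rowE.
have qB : mx_horner B (map_poly f q) = 0.
  apply: (can_inj (mulKmx Pu)); rewrite mulmx0; apply/row_matrixP=> i.
  rewrite row_mul (mx_horner_eigenvector _ (PB i)) row0.
  have /complex_realP[a spE] := mxOverP sp_real 0 i.
  suff /A_theta[j aE] : eigenvalue A a.
    rewrite spE aE rmorph_prod horner_prod (bigD1 j) //= rmorphB /=.
    by rewrite map_polyX map_polyC hornerXsubC subrr mul0r scale0r.
  rewrite -(eigenvalue_map f); apply/eigenvalueP; exists (row i P).
    by rewrite PB spE.
  by apply: row_free_row_neq0; rewrite row_free_unit.
by apply: (map_mx_inj (f := f)); rewrite mapE qB map_mx0.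
Qed.

End SymmetricReal.

(** * Functions of a symmetric matrix with known spectrum *)

Section Spectrum.
Variables (R : rcfType) (n : nat) (A : 'M[R]_n).
Variables (d : nat) (theta : 'I_d.+1 -> R).
Hypothesis AT : A^T = A.
Hypothesis theta_inj : injective theta.
Hypothesis spec : forall a, eigenvalue A a <-> exists i, a = theta i.
Implicit Types f g : {poly R}.

Lemma mx_horner_root f i : mx_horner A f = 0 -> f.[theta i] = 0.
Proof.
move=> fA; have /eigenvalueP[v vA v_neq0] : eigenvalue A (theta i).
  by apply/spec; exists i.
have := mx_horner_eigenvector f vA; rewrite fA mulmx0 => /esym/eqP.
by rewrite scaler_eq0 (negPf v_neq0) orbF => /eqP.
Qed.

Lemma mx_horner_eq0_small f : (size f <= d.+1)%N -> mx_horner A f = 0 -> f = 0.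
Proof.
move=> size_f fA; apply: (@roots_geq_poly_eq0 _ f (codom theta)).
- by apply/allP=> _ /codomP[i ->]; apply/rootP/mx_horner_root.
- by rewrite map_inj_uniq ?enum_uniq.
- by rewrite size_codom card_ord.
Qed.

Definition spectral_poly : {poly R} := \prod_i ('X - (theta i)%:P).

Lemma size_spectral_poly : size spectral_poly = d.+2.
Proof. by rewrite size_prod_XsubC [index_enum _]unlock -enumT size_enum_ord. Qed.

Lemma spectral_poly_root : mx_horner A spectral_poly = 0.
Proof. by apply: symmetric_annihilated => // a /spec. Qed.

Lemma mx_horner_modp f : mx_horner A (f %% spectral_poly) = mx_horner A f.
Proof.
rewrite [in RHS](divp_eq f spectral_poly) rmorphD rmorphM /=.
by rewrite spectral_poly_root mulr0 add0r.
Qed.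

Lemma size_modp_spectral_poly f : (size (f %% spectral_poly)%R <= d.+1)%N.
Proof.
rewrite -ltnS -size_spectral_poly ltn_modp -size_poly_gt0.
by rewrite size_spectral_poly.
Qed.

(** A polynomial that vanishes on the spectrum is divisible by the
    annihilating polynomial, so the function of A depends on values only. *)
Lemma mx_horner_values f g :
  (forall i, f.[theta i] = g.[theta i]) -> mx_horner A f = mx_horner A g.
Proof.
move=> fg; apply/eqP; rewrite -subr_eq0 -linearB /= -mx_horner_modp.
suff -> : (f - g) %% spectral_poly = 0 by rewrite linear0.
apply/modp_eq0P; rewrite /spectral_poly.
rewrite -(big_map theta predT (fun a => 'X - a%:P)).
apply: uniq_roots_dvdp; last first.
  by rewrite uniq_rootsE map_inj_uniq // index_enum_uniq.
by apply/allP=> _ /mapP[i _ ->]; rewrite rootE !hornerE fg subrr.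
Qed.

(** The Lagrange interpolation polynomial of the node [theta i]; evaluated at
    A it is the projection onto the eigenspace of [theta i] along the other
    eigenspaces. *)
Definition spectral_lagrange (i : 'I_d.+1) : {poly R} :=
  (spectral_psi theta i)^-1 *: \prod_(j | j != i) ('X - (theta j)%:P).

Lemma spectral_psi_neq0 i : spectral_psi theta i != 0.
Proof.
by apply/prodf_neq0 => j ji; rewrite subr_eq0; apply: contra_neq ji => /theta_inj.
Qed.

Lemma spectral_lagrange_value i j : (spectral_lagrange i).[theta j] = (i == j)%:R.
Proof.
rewrite hornerZ horner_prod; have [<-|ij] := eqVneq i j.
  under eq_bigr do rewrite hornerXsubC.
  by rewrite mulVf ?spectral_psi_neq0.
by rewrite (bigD1 j) 1?eq_sym //= hornerXsubC subrr mul0r mulr0.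
Qed.

Lemma mxrank_spectral_lagrange i :
  \rank (mx_horner A (spectral_lagrange i)) =
  \rank (eigenspace A (theta i)).
Proof.
apply/eqmx_rank/andP; split.
  apply/eigenspaceP; rewrite -{2}[A]mx_hornerX -[LHS]rmorphM -linearZ /=.
  apply: mx_horner_values => j.
  rewrite hornerM hornerX -mul_polyC hornerM hornerC spectral_lagrange_value.
  by have [->|] := eqVneq i j; rewrite ?mulr1 ?mul1r ?mulr0 ?mul0r.
apply/row_subP=> k; set v := row k _.
have vA : v *m A = theta i *: v by apply/eigenspaceP; rewrite row_sub.
have <- : v *m mx_horner A (spectral_lagrange i) = v; last exact: submxMl.
by rewrite (mx_horner_eigenvector _ vA) spectral_lagrange_value eqxx scale1r.
Qed.

(** The Lagrange polynomials decompose [mx_horner A f] into scaled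
    idempotents, whose traces are their ranks, the multiplicities. *)
Lemma mxtrace_horner f :
  \tr (mx_horner A f) =
  \sum_i (\rank (eigenspace A (theta i)))%:R * f.[theta i].
Proof.
have -> : mx_horner A f =
    mx_horner A (\sum_i f.[theta i] *: spectral_lagrange i).
  apply: mx_horner_values => j; rewrite horner_sum (bigD1 j) //= hornerZ.
  rewrite spectral_lagrange_value eqxx.
  rewrite mulr1 big1 ?addr0 // => i ij.
  by rewrite hornerZ spectral_lagrange_value (negPf ij) mulr0.
rewrite (linear_sum (mx_horner A)) [LHS]linear_sum /=; apply: eq_bigr => i _.
rewrite [mx_horner A _]linearZ mxtraceZ mulrC; congr (_ * _).
rewrite mxtrace_idempotent ?mxrank_spectral_lagrange //.
rewrite -[LHS](rmorphM (mx_horner A)).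
apply: mx_horner_values => j; rewrite hornerM spectral_lagrange_value.
by case: (i == j); rewrite ?mulr0 ?mulr1.
Qed.

End Spectrum.

(** * The distance of a connected graph *)

Section Distance.
Variables (X : finType) (e : rel X).
Hypothesis simple_e : simple_graph e.
Hypothesis connected_e : connected_graph e.
Implicit Types (x y z : X) (k : nat).

(** A path without repetition has fewer than #|X| steps, so the bounded search
    in [dist] succeeds. *)
Lemma walk_of_dist x y : walk_of_length e x y (dist e x y).
Proof.
have has_walk : has (walk_of_length e x y) (iota 0 #|X|).
  have /connectP[p0 p0_path ->] := connected_e x y.
  case/shortenP: p0_path => p p_path p_uniq _; apply/hasP; exists (size p).
    have := max_card (mem (x :: p)).
    by rewrite (card_uniqP p_uniq) mem_iota add0n.
  by apply/existsP; exists (in_tuple p); rewrite p_path eqxx.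
have := nth_find 0%N has_walk; rewrite nth_iota //.
by move: has_walk; rewrite has_find size_iota.
Qed.

Lemma dist_le_walk x y k : walk_of_length e x y k -> (dist e x y <= k)%N.
Proof.
move=> xy_walk; rewrite leqNgt; apply/negP=> k_lt.
have := before_find 0%N k_lt; rewrite nth_iota ?xy_walk //.
by apply: leq_trans k_lt _; rewrite -[leqRHS](size_iota 0) find_size.
Qed.

Lemma walk_of_length_sym x y k : walk_of_length e x y k -> walk_of_length e y x k.
Proof.
have [sym_e _] := simple_e; case/existsP=> p /andP[p_path /eqP <-].
have size_rev : size (rev (belast x p)) == k.
  by rewrite size_rev size_belast size_tuple.
apply/existsP; exists (Tuple size_rev) => /=.
rewrite rev_path (eq_path (_ : _ =2 e)) ?p_path => [/=|u v]; last exact: sym_e.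
by case: (tval p) => //= u s; rewrite rev_cons last_rcons.
Qed.

Lemma dist_sym x y : dist e x y = dist e y x.
Proof.
by apply/eqP; rewrite eqn_leq; apply/andP; split;
  apply/dist_le_walk/walk_of_length_sym/walk_of_dist.
Qed.

Lemma dist_eq0 x y : (dist e x y == 0%N) = (x == y).
Proof.
apply/eqP/eqP=> [xy0|->].
  have := walk_of_dist x y; rewrite xy0 => /existsP[p].
  by rewrite tuple0 => /eqP.
apply/eqP; rewrite -leqn0; apply: dist_le_walk; apply/existsP.
by exists [tuple]; rewrite /= eqxx.
Qed.

Lemma dist_step x z y : e x z -> (dist e x y <= (dist e z y).+1)%N.
Proof.
move=> xz; apply: dist_le_walk.
have /existsP[p /andP[p_path p_last]] := walk_of_dist z y.
by apply/existsP; exists [tuple of z :: p]; rewrite /= xz p_path p_last.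
Qed.

Lemma dist_eq1 x y : (dist e x y == 1%N) = e x y.
Proof.
have [_ irr_e] := simple_e; apply/eqP/idP=> [xy1|xy].
  have := walk_of_dist x y; rewrite xy1 => /existsP[p].
  by case/tupleP: p => z p; rewrite tuple0 /= andbT => /andP[xz /eqP <-].
apply/eqP; rewrite eqn_leq lt0n dist_eq0; apply/andP; split.
  apply: leq_trans (dist_step y xy) _; rewrite ltnS leqn0.
  by rewrite dist_eq0.
by apply: contraTneq xy => ->; rewrite irr_e.
Qed.

Lemma dist_le_diameter x y : (dist e x y <= diameter e)%N.
Proof.
by apply: leq_trans (leq_bigmax x); apply: leq_bigmax.
Qed.

Lemma diameter_le k : (forall x y, dist e x y <= k)%N -> (diameter e <= k)%N.
Proof. by move=> le_k; apply/bigmax_leqP=> x _; apply/bigmax_leqP. Qed.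

End Distance.

(** * Distance matrices and the Laplacian *)

Section Laplacian.
Variables (R : rcfType) (X : finType) (e : rel X).
Hypothesis simple_e : simple_graph e.
Hypothesis connected_e : connected_graph e.
Local Notation L := (laplacian R e).
Implicit Types (f : {poly R}) (i j : 'I_#|X|).

Definition dist_mx k : 'M[R]_#|X| :=
  \matrix_(i, j) (dist e (enum_val i) (enum_val j) == k)%:R.

Lemma sum_enum_val (F : X -> R) : \sum_(i < #|X|) F (enum_val i) = \sum_x F x.
Proof. by rewrite -big_enum_val; apply: eq_bigl. Qed.

Lemma sum_enum_val_card (P : pred X) :
  \sum_(i < #|X|) (P (enum_val i))%:R = #|[set x | P x]|%:R :> R.
Proof.
rewrite (sum_enum_val (fun x => (P x)%:R)) -sum1dep_card natr_sum.
rewrite [RHS]big_mkcond /=.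
by apply: eq_bigr => x _; case: (P x).
Qed.

Lemma sum_dist_mx k i : \sum_j dist_mx k i j = #|sphere e k (enum_val i)|%:R.
Proof.
rewrite -(sum_enum_val_card (fun y => dist e (enum_val i) y == k)).
by apply: eq_bigr => j _; rewrite mxE.
Qed.

Lemma dist_mx_mul a b i j : (dist_mx a *m dist_mx b) i j =
  #|sphere e a (enum_val i) :&: sphere e b (enum_val j)|%:R.
Proof.
pose P z := (dist e (enum_val i) z == a) && (dist e (enum_val j) z == b).
have -> : sphere e a (enum_val i) :&: sphere e b (enum_val j) = [set z | P z].
  by apply/setP=> z; rewrite !inE.
rewrite mxE -(sum_enum_val_card P); apply: eq_bigr => l _.
by rewrite !mxE -natrM mulnb [dist e (enum_val l) _]dist_sym.
Qed.

Lemma dist_mx_sym a : (dist_mx a)^T = dist_mx a.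
Proof. by apply/matrixP=> i j; rewrite !mxE dist_sym. Qed.

Lemma dist_mx0 : dist_mx 0 = 1%:M.
Proof.
by apply/matrixP=> i j; rewrite !mxE dist_eq0 // (inj_eq enum_val_inj).
Qed.

Lemma trmx_laplacian : L^T = L.
Proof.
have [sym_e _] := simple_e; rewrite linearB /= tr_diag_mx; congr (_ - _).
by apply/matrixP=> i j; rewrite !mxE sym_e.
Qed.

Lemma laplacian_local i j :
  L i j != 0 -> i = j \/ e (enum_val i) (enum_val j).
Proof.
rewrite !mxE; have [->|ij] := eqVneq i j; first by left.
by case: (e _ _); [right|rewrite mulr0n subrr eqxx].
Qed.

Lemma laplacian_mul_row (v : 'rV_#|X|) i : (v *m L) 0 i =
  \sum_j (e (enum_val i) (enum_val j))%:R * (v 0 i - v 0 j).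
Proof.
have [sym_e _] := simple_e.
rewrite mulmxBr mul_mx_diag !mxE.
rewrite -(sum_enum_val_card (e (enum_val i))) mulr_sumr -sumrB.
by apply: eq_bigr => j _; rewrite mxE sym_e mulrBr; congr (_ - _); rewrite mulrC.
Qed.

Lemma laplacian_const (a : R) : (const_mx a : 'rV_#|X|) *m L = 0.
Proof.
apply/rowP=> i; rewrite laplacian_mul_row [RHS]mxE big1 // => j _.
by rewrite !mxE subrr mulr0.
Qed.

(** Maximum principle: where v is maximal, the entry of v L is a sum of
    nonnegative differences over the neighbours. These differences vanish, so
    v is maximal at the neighbours as well, and then everywhere by
    connectedness. *)
Lemma laplacian_ker (v : 'rV_#|X|) : v *m L = 0 -> forall i j, v 0 i = v 0 j.
Proof.
have [sym_e _] := simple_e; move=> vL0 i0.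
pose m := [arg max_(i > i0) v 0 i]%O.
have max_m i : v 0 i <= v 0 m.
  by rewrite /m; case: arg_maxP => // k _ /(_ i isT).
pose M : {pred X} := [pred x | v 0 (enum_rank x) == v 0 m].
have M_closed x y : e x y -> x \in M -> y \in M.
  rewrite !inE => xy /eqP xM; have := laplacian_mul_row v (enum_rank x).
  rewrite vL0 mxE => /esym sum0.
  have term_ge0 k : true -> 0 <=
      (e (enum_val (enum_rank x)) (enum_val k))%:R *
      (v 0 (enum_rank x) - v 0 k).
    by move=> _; rewrite mulr_ge0 ?ler0n // subr_ge0 xM max_m.
  have /eqP := psumr_eq0P term_ge0 sum0 (i := enum_rank y) isT.
  by rewrite !enum_rankK xy mul1r subr_eq0 xM eq_sym.
have all_max i : v 0 i = v 0 m.
  have := closed_connect (intro_closed (sym_connect_sym sym_e) M_closed)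
    (connected_e (enum_val m) (enum_val i)).
  by rewrite !inE !enum_valK eqxx => /esym/eqP.
by move=> j; rewrite !all_max.
Qed.

(** Every factor L moves along at most one edge. *)
Lemma laplacian_exp_local k i j :
  (L ^+ k) i j != 0 -> (dist e (enum_val i) (enum_val j) <= k)%N.
Proof.
elim: k i => [|k IH] i.
  rewrite expr0 mxE; have [->|] := eqVneq i j; last by rewrite eqxx.
  by rewrite leqn0 dist_eq0 // eqxx.
rewrite exprS mxE => sum_neq0; have [l] : exists l, L i l * (L ^+ k) l j != 0.
  apply/existsP; apply: contra_neqT sum_neq0 => /existsPn sum0.
  by apply: big1 => l _; apply/eqP/negbNE.
rewrite mulf_eq0 negb_or => /andP[/laplacian_local[->|il] /IH lj_le].
  exact: leqW.
by apply: leq_trans (dist_step _ _ il) _.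
Qed.

Lemma laplacian_poly_local f i j :
  (size f <= dist e (enum_val i) (enum_val j))%N -> mx_horner L f i j = 0.
Proof.
move=> size_f; rewrite summxE big1 // => k _; rewrite mxE.
suff -> : (L ^+ k) i j = 0 by rewrite mulr0.
apply: contraTeq (leq_trans (ltn_ord k) size_f) => /laplacian_exp_local.
by rewrite -leqNgt.
Qed.

Lemma laplacian_poly_const f (a : R) :
  (const_mx a : 'rV_#|X|) *m mx_horner L f = f.[0] *: const_mx a.
Proof. by apply: mx_horner_eigenvector; rewrite laplacian_const scale0r. Qed.

Lemma laplacian_poly_sum f i : \sum_j mx_horner L f i j = f.[0].
Proof.
have /rowP/(_ i) := laplacian_poly_const f 1; rewrite !mxE mulr1 => <-.
apply: eq_bigr => j _; rewrite mxE mul1r -[in RHS]mx_horner_trmx ?mxE //.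
exact: trmx_laplacian.
Qed.

End Laplacian.
(** * The scalar product and the predistance polynomials *)

Section LaplacianDot.
Variables (R : rcfType) (X : finType) (e : rel X).
Hypothesis simple_e : simple_graph e.
Hypothesis card_X : (2 <= #|X|)%N.
Local Notation L := (laplacian R e).
Local Notation dot := (laplacian_dot (R := R) e).
Implicit Types (f g h : {poly R}).

Lemma dotE f g : dot f g = #|X|%:R^-1 * \tr (mx_horner L (f * g)).
Proof. by rewrite rmorphM. Qed.

Lemma dot_is_linear f : linear_for *%R (dot f).
Proof.
move=> a g h; rewrite !dotE mulrDr linearD linearD /= mulrDr.
by rewrite -scalerAr linearZ mxtraceZ mulrCA.
Qed.

HB.instance Definition _ f :=
  GRing.isLinear.Build R {poly R} R *%R (laplacian_dot (R := R) e f)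
    (dot_is_linear f).

Lemma dotZ a f g : dot f (a *: g) = a * dot f g.
Proof. exact: linearZ. Qed.

Lemma dotC f g : dot f g = dot g f.
Proof. by rewrite !dotE [f * g]mulrC. Qed.

Lemma dot_mulr f g h : dot f (g * h) = dot (g * f) h.
Proof. by rewrite !dotE mulrA [f * g]mulrC. Qed.

Lemma natr_card_gt0 : 0 < #|X|%:R :> R.
Proof. by rewrite ltr0n; apply: leq_trans card_X. Qed.

Lemma dot_ge0 f : 0 <= dot f f.
Proof.
rewrite /laplacian_dot mxtrace_sqr_symmetric ?mx_horner_trmx ?trmx_laplacian //.
rewrite mulr_ge0 ?invr_ge0 ?ler0n //; do 2![apply: sumr_ge0 => ? _].
exact: sqr_ge0.
Qed.

Lemma dot_eq0 f : dot f f = 0 -> mx_horner L f = 0.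
Proof.
move=> /eqP; rewrite mulf_eq0 invr_eq0 gt_eqF ?natr_card_gt0 //= => /eqP.
by apply: mxtrace_sqr_eq0; rewrite mx_horner_trmx ?trmx_laplacian.
Qed.

End LaplacianDot.

Section Predistance.
Variables (R : rcfType) (X : finType) (e : rel X).
Hypothesis simple_e : simple_graph e.
Hypothesis connected_e : connected_graph e.
Hypothesis card_X : (2 <= #|X|)%N.
Variables (d : nat) (theta : 'I_d.+1 -> R).
Hypothesis spec : laplacian_spectrum e theta.
Variable r : 'I_d.+1 -> {poly R}.
Hypothesis r_predistance : laplacian_predistance e r.
Local Notation L := (laplacian R e).
Local Notation dot := (laplacian_dot (R := R) e).
Local Notation n := (#|X|%:R : R).
Local Notation J := (const_mx 1 : 'M[R]_#|X|).
Implicit Types (f g h : {poly R}).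

Let LT : L^T = L := trmx_laplacian R simple_e.

Lemma theta_inj : injective theta.
Proof.
have [_ theta_lt _] := spec; move=> i j ij; apply/val_inj/eqP.
by case: ltngtP => //= /theta_lt; rewrite ij ltxx.
Qed.

#[local] Hint Resolve theta_inj : core.

Let specL a : eigenvalue L a <-> exists i, a = theta i.
Proof. by case: spec. Qed.

Let size_r k : size (r k) = k.+1.
Proof. by case: r_predistance. Qed.

Let n_neq0 : n != 0.
Proof. by rewrite gt_eqF // natr_card_gt0. Qed.

Lemma predistance_gt0 i : 0 < (r i).[0].
Proof.
have [_ _ norm_r] := r_predistance.
rewrite -norm_r lt_neqAle dot_ge0 // andbT eq_sym; apply/eqP.
move=> /(dot_eq0 simple_e card_X).
move/(mx_horner_eq0_small theta_inj specL); rewrite size_r => /(_ (ltn_ord i)) r0.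
by have := size_r i; rewrite r0 size_poly0.
Qed.

(** There is one r_j in each degree, so the leading term of g can be removed
    by a multiple of the r_j of the same degree. *)
Lemma dot_small_eq0 m f g : (m <= d.+1)%N ->
  (forall j : 'I_d.+1, (j < m)%N -> dot f (r j) = 0) ->
  (size g <= m)%N -> dot f g = 0.
Proof.
elim: m g => [|m IH] g m_le f_r.
  by rewrite leqn0 size_poly_eq0 => /eqP->; rewrite linear0.
move=> size_g; pose j := Ordinal m_le; pose c := g`_m / (r j)`_m.
rewrite -(subrK (c *: r j) g) linearD /= dotZ f_r // mulr0 addr0.
apply: IH => [|i im|]; [exact: ltnW|by apply: f_r; apply: ltnW|].
by apply: size_sub_lead; rewrite ?size_r.
Qed.

(** The difference of both sides comes from a polynomial g orthogonal to every
    r_j. Its remainder h modulo the annihilating polynomial has the same value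
    at L and degree at most d, so <h, h> = <g, h> = 0 and h(L) = 0. *)
Lemma predistance_expansion f :
  mx_horner L f = \sum_j (dot f (r j) / (r j).[0]) *: mx_horner L (r j).
Proof.
have [_ orth_r norm_r] := r_predistance.
pose g := f - \sum_j (dot f (r j) / (r j).[0]) *: r j.
have g_r j : dot g (r j) = 0.
  rewrite dotC linearB linear_sum /= (bigD1 j) //= dotZ norm_r.
  rewrite divfK ?gt_eqF ?predistance_gt0 // dotC big1 ?addr0 ?subrr // => i ij.
  by rewrite dotZ orth_r 1?eq_sym // mulr0.
suff : mx_horner L g = 0.
  rewrite linearB /= (linear_sum (mx_horner L)) => /eqP.
  rewrite subr_eq0 => /eqP ->.
  by apply: eq_bigr => j _; apply: mx_hornerZ.
rewrite -(mx_horner_modp LT specL); set h := _ %% _.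
have hE : mx_horner L h = mx_horner L g by apply: mx_horner_modp.
apply: (dot_eq0 simple_e card_X).
rewrite [LHS](_ : _ = dot g h); last by rewrite /laplacian_dot hE.
apply: (dot_small_eq0 (leqnn _)) => [j _|]; first exact: g_r.
exact: size_modp_spectral_poly.
Qed.

(** The rows of this matrix lie in the kernel of L, so they are constant; by
    symmetry the whole matrix is constant, and its row sums are the value 1 of
    the polynomial at 0. *)
Lemma lagrange0_allones : mx_horner L (spectral_lagrange theta ord0) = n^-1 *: J.
Proof.
have [theta0 _ _] := spec; set M := mx_horner _ _.
have ML : M *m L = 0.
  rewrite -[X in M *m X]mx_hornerX -[LHS](rmorphM (mx_horner L)).
  rewrite -(linear0 (mx_horner L)).
  apply: mx_horner_values LT theta_inj specL _ _ _ => j /=.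
  rewrite hornerM hornerX horner0 spectral_lagrange_value //.
  by have [<-|] := eqVneq; rewrite ?theta0 ?mulr0 ?mul0r.
have MT i j : M i j = M j i.
  by rewrite -[in RHS](mx_horner_trmx _ LT : M^T = M) mxE.
have M_row i j k : M i j = M i k.
  have := laplacian_ker simple_e connected_e (v := row i M).
  by rewrite -row_mul ML row0 => /(_ erefl j k); rewrite !mxE.
have M_const i j k l : M i j = M k l.
  by rewrite (M_row i j l) MT (M_row l i k) MT.
apply/matrixP=> i j; rewrite !mxE mulr1.
have := laplacian_poly_sum simple_e (spectral_lagrange theta ord0) i.
rewrite -[X in _.[X]]theta0 spectral_lagrange_value ?eqxx //.
rewrite (eq_bigr (fun=> M i j)) => [|k _]; last exact: M_const.
rewrite sumr_const card_ord -[M i j *+ _]mulr_natl => nM.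
by apply: (mulfI n_neq0); rewrite nM mulfV.
Qed.

Lemma allones_mul f : J *m mx_horner L f = f.[0] *: J.
Proof.
apply/row_matrixP=> i; rewrite row_mul row_const laplacian_poly_const //.
by apply/rowP=> j; rewrite !mxE.
Qed.

(** Expansion of J in the orthogonal basis of the r_j(L). Since J r_j(L) =
    r_j(0) J has trace n r_j(0), the scalar product of J with r_j is r_j(0),
    which is also the squared norm of r_j: all coefficients are 1. The sum of
    the r_j is the Hoffman polynomial of the Laplacian. *)
Lemma hoffman : \sum_j mx_horner L (r j) = J.
Proof.
have <- : mx_horner L (n *: spectral_lagrange theta ord0) = J.
  by rewrite mx_hornerZ lagrange0_allones scalerA mulfV // scale1r.
rewrite predistance_expansion; apply: eq_bigr => j _.
suff -> : dot (n *: spectral_lagrange theta ord0) (r j) = (r j).[0].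
  by rewrite divff ?scale1r ?gt_eqF ?predistance_gt0.
rewrite dotC dotZ dotC /laplacian_dot lagrange0_allones -scalemxAl allones_mul.
rewrite !mxtraceZ [\tr _](eq_bigr (fun=> 1)) => [|i _]; last by rewrite mxE.
by rewrite sumr_const card_ord; field.
Qed.

Lemma predistance_sum0 : \sum_j (r j).[0] = n.
Proof.
have i0 : 'I_#|X| := Ordinal (ltnW card_X).
transitivity (\sum_j J i0 j); last first.
  by rewrite (eq_bigr (fun=> 1)) ?sumr_const ?card_ord // => j _; rewrite mxE.
rewrite -hoffman; under [RHS]eq_bigr do rewrite summxE.
by rewrite exchange_big; apply: eq_bigr => j _; rewrite laplacian_poly_sum.
Qed.

(** * The value of the top predistance polynomial at 0 *)

Section TopValue.
Local Notation mult i := ((multiplicity e (theta i))%:R : R).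

Lemma multiplicity_neq0 i : mult i != 0.
Proof.
rewrite pnatr_eq0 mxrank_eq0 -[_ != 0]/(eigenvalue L (theta i)).
by apply/specL; exists i.
Qed.

Lemma multiplicity0 : mult ord0 = 1.
Proof.
have := mxtrace_horner LT theta_inj specL (spectral_lagrange theta ord0).
rewrite (bigD1 ord0) //= big1 => [|i /negPf i0]; last first.
  by rewrite spectral_lagrange_value // eq_sym i0 mulr0.
rewrite spectral_lagrange_value // eqxx mulr1 addr0 => <-.
rewrite lagrange0_allones mxtraceZ.
rewrite [\tr _](eq_bigr (fun=> 1)) => [|i _]; last by rewrite mxE.
by rewrite sumr_const card_ord mulVf.
Qed.

Lemma dot_lagrange f i :
  dot f (spectral_lagrange theta i) = n^-1 * (mult i * f.[theta i]).
Proof.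
rewrite dotE (mxtrace_horner LT theta_inj specL) (bigD1 i) //=.
rewrite big1 => [|j /negPf ji].
  by rewrite hornerM spectral_lagrange_value // eqxx mulr1 addr0.
by rewrite hornerM spectral_lagrange_value // eq_sym ji !mulr0.
Qed.

Lemma psi_lagrange i :
  spectral_psi theta i *: spectral_lagrange theta i =
  \prod_(j | j != i) ('X - (theta j)%:P).
Proof. by rewrite scalerA mulfV ?scale1r ?spectral_psi_neq0. Qed.

Lemma psi_lagrange_lead i k : (d <= k)%N ->
  (spectral_psi theta i *: spectral_lagrange theta i)`_k = (k == d)%:R.
Proof.
rewrite psi_lagrange -big_filter => d_le; set s := filter _ _.
have size_s : size s = d.
  rewrite -(card_uniqP _) ?filter_uniq ?index_enum_uniq //.
  rewrite (eq_card (B := predC1 i)) ?cardC1 ?card_ord // => j.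
  by rewrite mem_filter mem_index_enum andbT.
have size_p := size_prod_XsubC s theta; rewrite size_s in size_p.
have [->|/negPf k_neq] := eqVneq k d.
  by have /monicP := monic_prod_XsubC s predT theta; rewrite lead_coefE size_p.
by rewrite nth_default // size_p ltn_neqAle eq_sym k_neq.
Qed.

(** The monic polynomials [\prod_(j | j != i) ('X - (theta j)%:P)] for i and
    for 0 differ by a polynomial of degree less than d, to which r_d is
    orthogonal; each of them is nonzero at a single eigenvalue, and 0 has
    multiplicity 1. *)
Lemma predistance_top_value i :
  mult i * (r ord_max).[theta i] * spectral_psi theta i =
  (r ord_max).[0] * spectral_psi theta ord0.
Proof.
have [theta0 _ _] := spec; have [_ orth_r _] := r_predistance.
pose p i := spectral_psi theta i *: spectral_lagrange theta i.
have /eqP : dot (r ord_max) (p i - p ord0) = 0.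
  apply: (dot_small_eq0 (leqnSn d)) => [j j_lt|].
    by rewrite orth_r // eq_sym; apply: contraTneq j_lt => ->; rewrite ltnn.
  by apply/leq_sizeP=> k d_le; rewrite coefB !psi_lagrange_lead // subrr.
rewrite linearB /= subr_eq0 [dot _ (p i)]dotZ [dot _ (p ord0)]dotZ.
rewrite !dot_lagrange multiplicity0 mul1r theta0 => /eqP pE.
apply: (mulfI (invr_neq0 n_neq0)); rewrite [_ * spectral_psi _ _]mulrC.
by rewrite mulrCA pE mulrCA [_.[0] * _]mulrC.
Qed.

(** Insert the values of r_d on the spectrum into n r_d(0) = n <r_d, r_d>. *)
Lemma predistance_top0 :
  (r ord_max).[0] *
    (\sum_i spectral_psi theta ord0 ^+ 2 /
       (mult i * spectral_psi theta i ^+ 2)) = n.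
Proof.
have [_ _ norm_r] := r_predistance.
set rd := r ord_max; have rd_neq0 : rd.[0] != 0.
  by rewrite gt_eqF // predistance_gt0.
have normE : rd.[0] * n = \sum_i mult i * (rd * rd).[theta i].
  by rewrite -norm_r dotE (mxtrace_horner LT theta_inj specL) mulrAC mulVf ?mul1r.
apply: (mulfI rd_neq0); rewrite normE mulrA mulr_sumr; apply: eq_bigr => i _.
have m0 := multiplicity_neq0 i; have psi0 := spectral_psi_neq0 theta_inj i.
have vE : rd.[theta i] =
    rd.[0] * spectral_psi theta ord0 / (mult i * spectral_psi theta i).
  by rewrite -(predistance_top_value i); field; rewrite m0 psi0.
by rewrite hornerM vE /multiplicity; field; rewrite m0 psi0.
Qed.

End TopValue.

(** * Equality of the harmonic mean with the value of the partial sum *)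

Local Notation distI i j := (dist e (enum_val i) (enum_val j)).

(** All entries of J = r_0(L) + ... + r_d(L) are nonzero, while a polynomial
    of degree at most d in L has zero entries beyond distance d. *)
Lemma dist_le_spectrum x y : (dist e x y <= d)%N.
Proof.
rewrite leqNgt; apply/negP=> d_lt.
have /matrixP/(_ (enum_rank x) (enum_rank y)) := hoffman.
rewrite summxE mxE big1 => [/esym/eqP|k _]; first by rewrite oner_eq0.
apply: laplacian_poly_local => //.
by rewrite !enum_rankK size_r; apply: leq_trans d_lt.
Qed.

Lemma spectrum_gt0 : (0 < d)%N.
Proof.
rewrite lt0n; apply/eqP=> d0; have := card_X; rewrite ltnNge => /negP; apply.
apply/card_le1_eqP=> x y _ _; apply/eqP; rewrite -(dist_eq0 connected_e) -leqn0.
by rewrite -[X in (_ <= X)%N]d0 dist_le_spectrum.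
Qed.

Section HarmonicMean.
Implicit Types (i j : 'I_#|X|).
Let s : {poly R} := \sum_(k < d.+1 | (k < d)%N) r k.

Lemma predistance_below_top0 : s.[0] = n - (r ord_max).[0].
Proof.
by rewrite horner_sum -predistance_sum0 big_ord_lt_last addrK.
Qed.

Lemma predistance_below_top_mx : mx_horner L s = J - mx_horner L (r ord_max).
Proof.
by rewrite -hoffman big_ord_lt_last addrK (linear_sum (mx_horner L)).
Qed.

Lemma size_predistance_below_top : (size s <= d)%N.
Proof.
apply: leq_trans (size_sum _ _ _) _.
by apply/bigmax_leqP=> k k_lt; rewrite size_r.
Qed.

Lemma predistance_below_top_gt0 : 0 < s.[0].
Proof.
rewrite horner_sum (bigD1 ord0) ?spectrum_gt0 //=.
rewrite ltr_wpDr ?predistance_gt0 // sumr_ge0 // => k _.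
by rewrite ltW ?predistance_gt0.
Qed.

Lemma dot_predistance_below_top : dot s s = s.[0].
Proof.
have [_ orth_r norm_r] := r_predistance.
rewrite [in LHS]/s linear_sum horner_sum /=; apply: eq_bigr => k k_lt.
rewrite dotC linear_sum (bigD1 k) //= norm_r big1 ?addr0 // => l /andP[_ lk].
by rewrite orth_r // eq_sym.
Qed.

Local Notation S := (mx_horner L s).

Lemma top_entry i j : distI i j = d -> S i j = 0.
Proof.
move=> ijd; apply: laplacian_poly_local => //.
by rewrite ijd size_predistance_below_top.
Qed.

Lemma sum_sqr_below_top : \sum_i \sum_j S i j ^+ 2 = n * s.[0].
Proof.
rewrite -mxtrace_sqr_symmetric ?mx_horner_trmx // -dot_predistance_below_top.
by rewrite mulVKf // gt_eqF // natr_card_gt0.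
Qed.

Local Notation w i := (n - #|sphere e d (enum_val i)|%:R : R).

Lemma cosphere_card i : w i = \sum_(j < #|X|) (distI i j != d)%:R.
Proof.
rewrite -sum_dist_mx (_ : n = \sum_(j < #|X|) 1); last first.
  by rewrite sumr_const card_ord.
rewrite -sumrB; apply: eq_bigr => j _; rewrite mxE.
by case: (_ == _); rewrite ?subr0 ?subrr.
Qed.

Lemma cosphere_card_gt0 i : 0 < w i.
Proof.
rewrite cosphere_card (bigD1 i) //=.
have -> : distI i i = 0%N by apply/eqP; rewrite dist_eq0.
by rewrite eq_sym -lt0n spectrum_gt0 ltr_wpDr // sumr_ge0.
Qed.

Hypothesis harmonic_mean :
  n / (\sum_(x : X) (n - #|sphere e d x|%:R)^-1) = s.[0].

(** Equality case of the Cauchy-Schwarz inequality in all rows at once: the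
    sum of the squares of the differences T of both sides is n s(0) - s(0)^2 *
    (sum over x of 1 / w x), which the harmonic mean condition makes zero. *)
Lemma below_top_entry i j : S i j = (distI i j != d)%:R * (s.[0] / w i).
Proof.
have s_gt0 := predistance_below_top_gt0.
have sum_w : \sum_(i < #|X|) s.[0] ^+ 2 / w i = n * s.[0].
  rewrite -mulr_sumr (sum_enum_val (fun x => (n - #|sphere e d x|%:R)^-1)).
  have /eqP := harmonic_mean; set W := \sum_x _.
  have [->|W_neq0 /eqP <-] := eqVneq W 0.
    by rewrite invr0 mulr0 eq_sym (gt_eqF s_gt0).
  by field.
pose T : 'M[R]_#|X| :=
  \matrix_(i, j) (S i j - (distI i j != d)%:R * (s.[0] / w i)).
have rowT (k : 'I_#|X|) :
    \sum_j T k j ^+ 2 = \sum_j S k j ^+ 2 - s.[0] ^+ 2 / w k.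
  have w_neq0 : w k != 0 by rewrite gt_eqF ?cosphere_card_gt0.
  have T2 (l : 'I_#|X|) : T k l ^+ 2 =
      S k l ^+ 2 - 2 * (s.[0] / w k) * S k l +
      (s.[0] / w k) ^+ 2 * (distI k l != d)%:R.
    rewrite mxE; have [/top_entry->|_] := eqVneq (distI k l) d;
      rewrite /= ?mul0r ?mul1r; ring.
  rewrite (eq_bigr _ (fun l _ => T2 l)) big_split sumrB /= -!mulr_sumr.
  rewrite laplacian_poly_sum // -cosphere_card; field; exact: w_neq0.
have sumT : \sum_i \sum_j T i j ^+ 2 = 0.
  by rewrite (eq_bigr _ (fun k _ => rowT k)) sumrB sum_sqr_below_top sum_w subrr.
have /matrixP/(_ i j) := sum_sqr_mx_eq0 sumT.
by rewrite !mxE => /eqP; rewrite subr_eq0 => /eqP.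
Qed.

Lemma below_top_entry_sym i j : distI i j != d -> s.[0] / w i = s.[0] / w j.
Proof.
move=> ij_neq; have := below_top_entry i j; have := below_top_entry j i.
rewrite (dist_sym simple_e connected_e) ij_neq !mul1r => <- <-.
by rewrite -[in LHS](mx_horner_trmx s LT) mxE.
Qed.

(** S is symmetric, so the row constants agree at vertices that are not at
    distance d. For d > 1 this covers adjacent vertices, and connectedness
    does the rest; for d = 1 the polynomial s is constant and S is a scalar
    matrix. *)
Lemma cosphere_ratio_const i j : s.[0] / w i = s.[0] / w j.
Proof.
have [d1|d_gt1] := leqP d 1.
  have [c sE] : exists c, s = c%:P.
    exists (s`_0); apply: size1_polyC.
    exact: leq_trans size_predistance_below_top d1.
  have diag (k : 'I_#|X|) : s.[0] / w k = c.
    have <- : S k k = c by rewrite sE mx_hornerC mxE eqxx.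
    rewrite below_top_entry.
    have -> : distI k k = 0%N by apply/eqP; rewrite dist_eq0.
    by rewrite eq_sym -lt0n spectrum_gt0 mul1r.
  by rewrite !diag.
pose a x := s.[0] / w (enum_rank x).
pose M : {pred X} := [pred x | a x == s.[0] / w i].
have [sym_e _] := simple_e.
have M_closed x y : e x y -> x \in M -> y \in M.
  rewrite !inE => xy /eqP <-; rewrite eq_sym; apply/eqP/below_top_entry_sym.
  rewrite !enum_rankK neq_ltn.
  by have /eqP -> : dist e x y == 1%N; rewrite ?dist_eq1 ?d_gt1.
have := closed_connect (intro_closed (sym_connect_sym sym_e) M_closed)
  (connected_e (enum_val i) (enum_val j)).
by rewrite !inE /a !enum_valK eqxx => /esym/eqP.
Qed.

(** By now S is a (J - A_d) for a constant a. As its entries are 0 or a, the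
    sum of their squares is a times their sum n s(0); it is also n s(0),
    whence a = 1. *)
Lemma predistance_top_dist_mx : mx_horner L (r ord_max) = dist_mx R e d.
Proof.
have s_neq0 : s.[0] != 0 by rewrite gt_eqF ?predistance_below_top_gt0.
pose i0 : 'I_#|X| := Ordinal (ltnW card_X); pose a := s.[0] / w i0.
have S_a i j : S i j = (distI i j != d)%:R * a.
  by rewrite below_top_entry (cosphere_ratio_const i i0).
have a1 : a = 1.
  have sum_a : \sum_i \sum_j S i j ^+ 2 = a * (n * s.[0]).
    transitivity (\sum_i a * \sum_j S i j).
      apply: eq_bigr => i _; rewrite mulr_sumr; apply: eq_bigr => j _; rewrite S_a.
      by case: (_ != _); rewrite /= ?mul0r ?expr0n ?mulr0 ?mul1r ?expr2.
    rewrite -mulr_sumr; congr (_ * _).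
    under eq_bigr do rewrite laplacian_poly_sum //.
    by rewrite sumr_const card_ord mulr_natl.
  have := sum_sqr_below_top; rewrite sum_a -[RHS]mul1r; apply: mulIf.
  by rewrite mulf_neq0.
apply/matrixP=> i j; have -> : mx_horner L (r ord_max) = J - S.
  by rewrite predistance_below_top_mx opprB addrC subrK.
rewrite !mxE S_a a1 mulr1.
by case: (_ == _); rewrite ?subr0 ?subrr.
Qed.

End HarmonicMean.

(** * Distance-regularity from the distance matrices *)

Local Notation A := (dist_mx R e).

Lemma dot_predistance_small_eq0 (l : 'I_d.+1) f :
  (size f <= l)%N -> dot (r l) f = 0.
Proof.
have [_ orth_r _] := r_predistance.
apply: dot_small_eq0 => [|j j_lt]; first exact: ltnW.
by rewrite orth_r // eq_sym; apply: contraTneq j_lt => ->; rewrite ltnn.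
Qed.

(** This coefficient of the three-term recurrence cannot vanish: otherwise r_l
    would be orthogonal to X r_k and to all lower degrees, hence to itself. *)
Lemma dot_predistance_subdiag_neq0 (k l : 'I_d.+1) :
  l = k.+1 :> nat -> dot (r l) ('X * r k) != 0.
Proof.
have [_ _ norm_r] := r_predistance.
move=> lk; apply/eqP=> dot0; have := predistance_gt0 l; rewrite -norm_r.
have size_Xr : size ('X * r k) = l.+1.
  by rewrite mulrC size_mulX -?size_poly_eq0 ?size_r // lk.
rewrite -[X in dot _ X](subrK (((r l)`_l / ('X * r k)`_l) *: ('X * r k))).
rewrite linearD /= dotZ dot0 mulr0 addr0 dot_predistance_small_eq0 ?ltxx //.
by rewrite size_sub_lead ?size_r.
Qed.

(** Downward induction on k, comparing entries at distance h. For h > k the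
    entry of r_k(L) vanishes by locality. For h = k only r_k contributes to
    the entry 1 of the sum J of all r_q(L). For h < k the entry of L A_{k+1}
    vanishes; in the expansion of L r_{k+1}(L) the coefficients of r_q with q
    < k are zero and the r_q(L) with q > k are distance matrices with zero
    entry, so a nonzero multiple of the entry of r_k(L) is zero. *)
Lemma predistance_dist_mx :
  mx_horner L (r ord_max) = A d -> forall k, mx_horner L (r k) = A k.
Proof.
have [sym_e _] := simple_e; move=> top k.
suff down t : (t <= d)%N ->
    forall k : 'I_d.+1, (d - t <= k)%N -> mx_horner L (r k) = A k.
  by apply: (down d) => //; rewrite subnn.
elim: t => [|t IH] t_le {}k k_ge.
  have -> : k = ord_max; last exact: top.
  by apply/val_inj/eqP; rewrite /= eqn_leq -ltnS ltn_ord -[X in (X <= _)%N]subn0.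
have {}IH := IH (ltnW t_le).
have [/IH //|k_lt] := leqP (d - t) k.
have lk : (k.+1 < d.+1)%N by rewrite ltnS; apply: leq_trans k_lt _; apply: leq_subr.
pose l := Ordinal lk.
have k_eq : (d - t)%N = k.+1.
  apply/eqP; rewrite eqn_leq k_lt andbT; move: k_ge; rewrite subnS.
  by case: (d - t)%N.
have above (q : 'I_d.+1) : (k < q)%N -> mx_horner L (r q) = A q.
  by move=> kq; apply: IH; rewrite k_eq.
apply/matrixP=> i j; rewrite mxE.
case: (ltngtP (distI i j) k) => [ij_lt|ij_gt|ij_eq].
- have LA0 : mx_horner L ('X * r l) i j = 0.
    rewrite rmorphM /= mx_hornerX above //= mxE big1 // => p _.
    have [->|/laplacian_local ip] := eqVneq (L i p) 0; first by rewrite mul0r.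
    rewrite [A _ p j]mxE.
    have [pj|] := eqVneq (distI p j) k.+1; last by rewrite mulr0.
    have : (distI p j <= (distI i j).+1)%N.
      by case: ip => [->|ip]; [exact: leqnSn|apply: dist_step; rewrite // sym_e].
    by rewrite pj ltnS leqNgt ij_lt.
  move: LA0; rewrite predistance_expansion summxE.
  rewrite (bigD1 k) //= big1 => [|q qk]; last first.
    rewrite mxE; case: (ltngtP q k) => [q_lt|q_gt|/val_inj q_eq].
    - rewrite mulrC [X in _ * (X / _)](_ : _ = 0) ?mul0r ?mulr0 //.
      rewrite -dot_mulr dot_predistance_small_eq0 //=.
      by rewrite mulrC size_mulX -?size_poly_eq0 ?size_r.
    - rewrite above // mxE.
      have [ij_q|] := eqVneq (distI i j) q; last by rewrite mulr0.
      by move: ij_lt; rewrite ij_q ltnNge (ltnW q_gt).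
    - by rewrite q_eq eqxx in qk.
  rewrite addr0 mxE -dot_mulr => /eqP.
  rewrite mulf_eq0 mulf_eq0 invr_eq0 (gt_eqF (predistance_gt0 k)) orbF.
  by rewrite (negPf (dot_predistance_subdiag_neq0 _)) // => /eqP.
- by rewrite laplacian_poly_local // size_r.
- have /matrixP/(_ i j) := hoffman.
  rewrite summxE mxE (bigD1 k) //= big1 ?addr0 // => q qk.
  case: (ltngtP q k) => [q_lt|q_gt|/val_inj q_eq].
  - by rewrite laplacian_poly_local // size_r ij_eq.
  - by rewrite above // mxE ij_eq ltn_eqF.
  - by rewrite q_eq eqxx in qk.
Qed.

(** A_a A_b is a polynomial in L, hence a combination of the A_k, so its
    entries, the sizes of intersections of spheres, depend on the distance
    only. The intersection number is the count at an arbitrary pair at that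
    distance. *)
Lemma distance_regular_of_dist_mx :
  (forall k, mx_horner L (r k) = A k) -> distance_regular e.
Proof.
move=> rA.
have count_eq (a b : nat) x y x' y' : dist e x y = dist e x' y' ->
    #|sphere e a x :&: sphere e b y| = #|sphere e a x' :&: sphere e b y'|.
  have far c z : (d < c)%N -> sphere e c z = set0.
    move=> dc; apply/setP=> u; rewrite !inE; apply/eqP=> zu.
    by have := dist_le_spectrum z u; rewrite zu leqNgt dc.
  move=> xy; have [a_le|/far a_far] := leqP a d; last by rewrite !a_far !set0I.
  have [b_le|/far b_far] := leqP b d; last by rewrite !b_far !setI0.
  have AA : A a *m A b = mx_horner L (r (inord a) * r (inord b)).
    by rewrite rmorphM /= !rA !inordK.
  apply/eqP; rewrite -(eqr_nat R).
  rewrite -[x]enum_rankK -[y]enum_rankK -[x']enum_rankK -[y']enum_rankK.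
  rewrite -!dist_mx_mul // AA predistance_expansion.
  rewrite !summxE; apply/eqP/eq_bigr => k _.
  by rewrite rA !mxE !enum_rankK xy.
(* The value 0 is for distances c that do not occur. *)
exists (fun c a b => if [pick xy : X * X | dist e xy.1 xy.2 == c] is Some xy
  then #|sphere e a xy.1 :&: sphere e b xy.2| else 0%N).
move=> c a b x y xy; case: pickP => [[x' y'] /= /eqP x'y'|/(_ (x, y))].
  by apply: count_eq; rewrite xy.
by rewrite /= xy eqxx.
Qed.

(** * The spectral excess of a distance-regular graph *)

Section SpectralExcess.
Hypothesis regular_e : distance_regular e.
Implicit Types (i j : 'I_#|X|) (k : 'I_d.+1).

(** A distance-regular graph is regular, so L is a scalar matrix minus A_1,
    and the entries of A_1 A_l are intersection numbers. *)
Lemma regular_mul_dist_mx (l : nat) :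
  exists c : 'I_d.+1 -> R, L *m A l = \sum_k c k *: A k.
Proof.
have [p p_count] := regular_e.
have LE : L = (p 0%N 1%N 1%N)%:R%:M - A 1.
  rewrite /laplacian; congr (_ - _); last first.
    by apply/matrixP=> i j; rewrite !mxE dist_eq1.
  rewrite -diag_const_mx; congr diag_mx; apply/rowP=> i; rewrite !mxE.
  congr (_%:R); rewrite -(p_count _ 1%N 1%N (enum_val i) (enum_val i)); last first.
    by apply/eqP; rewrite dist_eq0.
  by rewrite setIid; apply: eq_card => x; rewrite !inE dist_eq1.
exists (fun k => (p 0%N 1%N 1%N)%:R * (k == l :> nat)%:R - (p k 1%N l)%:R).
apply/matrixP=> i j; rewrite LE mulmxBl mul_scalar_mx.
rewrite mxE [X in _ + X]mxE [X in X + _]mxE.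
rewrite dist_mx_mul // (p_count _ _ _ _ _ erefl) summxE.
have ij_lt : (distI i j < d.+1)%N by rewrite ltnS dist_le_spectrum.
rewrite (bigD1 (Ordinal ij_lt)) //= big1 => [|k k_neq]; last first.
  rewrite mxE [A k i j]mxE.
  have [ij_k|] := eqVneq (distI i j) k; last by rewrite mulr0.
  by rewrite -val_eqE /= ij_k eqxx in k_neq.
by rewrite addr0 !mxE eqxx mulr1.
Qed.

Let powers : 'M[R]_(d.+1, #|X| * #|X|) := \matrix_(k < d.+1) mxvec (L ^+ k).
Let distances : 'M[R]_(d.+1, #|X| * #|X|) := \matrix_(k < d.+1) mxvec (A k).

Lemma row_free_powers : row_free powers.
Proof.
apply: inj_row_free => v vP; pose f := \poly_(k < d.+1) v 0 (inord k).
have f_coef k : f`_k = v 0 k by rewrite coef_poly ltn_ord inord_val.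
have fL : mx_horner L f = 0.
  apply: (can_inj mxvecK); rewrite linear0 -vP [f]poly_def.
  rewrite (linear_sum (mx_horner L)) linear_sum mulmx_sum_row.
  apply: eq_bigr => k _; rewrite /= mx_hornerZ rmorphXn /= mx_hornerX.
  by rewrite linearZ rowK inord_val.
have f0 : f = 0.
  by apply: mx_horner_eq0_small theta_inj specL _ _ fL; apply: size_poly.
by apply/rowP=> k; rewrite -f_coef f0 coef0 mxE.
Qed.

Lemma powers_sub_distances : (powers <= distances)%MS.
Proof.
apply/row_subP=> k; rewrite rowK; elim: (nat_of_ord k) => {k} [|k].
  by have := row_sub ord0 distances; rewrite rowK /= dist_mx0.
case/submxP=> c cE; have LkE : L ^+ k = \sum_l c 0 l *: A l.
  apply: (can_inj mxvecK); rewrite cE mulmx_sum_row linear_sum.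
  by apply: eq_bigr => l _; rewrite linearZ rowK.
rewrite exprS LkE [L * _]mulmx_sumr linear_sum summx_sub // => l _.
rewrite -scalemxAr linearZ scalemx_sub //.
have [c' ->] := regular_mul_dist_mx l; rewrite linear_sum summx_sub // => q _.
rewrite linearZ scalemx_sub //.
by have := row_sub q distances; rewrite rowK.
Qed.

Lemma mxrank_powers : \rank powers = d.+1.
Proof. by apply/eqP; exact: row_free_powers. Qed.

(** The d+1 independent powers lie in the span of the d+1 distance matrices,
    which is therefore spanned by them and of full dimension. *)
Lemma row_free_distances : row_free distances.
Proof.
rewrite /row_free eqn_leq rank_leq_row -{1}mxrank_powers.
exact: mxrankS powers_sub_distances.
Qed.

Lemma distances_sub_powers : (distances <= powers)%MS.
Proof.
rewrite -(mxrank_leqif_sup powers_sub_distances) mxrank_powers eq_sym.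
exact: row_free_distances.
Qed.

Lemma top_dist_mx_neq0 : A d != 0.
Proof.
have := row_free_row_neq0 ord_max row_free_distances.
by rewrite rowK; apply: contraNneq => ->; rewrite linear0.
Qed.

Lemma regular_diameter : diameter e = d.
Proof.
apply/eqP; rewrite eqn_leq diameter_le /=; last exact: dist_le_spectrum.
have /existsP[[i j]] : [exists ij : 'I_#|X| * 'I_#|X|, A d ij.1 ij.2 != 0].
  apply: contraNT top_dist_mx_neq0 => /existsPn A0; apply/eqP/matrixP=> i j.
  by rewrite [RHS]mxE; apply/eqP/negbNE/(A0 (i, j)).
rewrite mxE /=; have [ij _|] := eqVneq (distI i j) d; last by rewrite eqxx.
by rewrite -[X in (X <= _)%N]ij dist_le_diameter.
Qed.

Lemma top_dist_mx_horner : exists f : {poly R}, mx_horner L f = A d.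
Proof.
have /row_subP/(_ ord_max) := distances_sub_powers.
rewrite rowK => /submxP[c cE]; exists (\sum_k c 0 k *: 'X^k).
apply: (can_inj mxvecK); rewrite cE mulmx_sum_row.
rewrite (linear_sum (mx_horner L)) linear_sum; apply: eq_bigr => k _.
by rewrite /= mx_hornerZ rmorphXn /= mx_hornerX linearZ rowK.
Qed.

(** A_d = f(L) is orthogonal to r_0, ..., r_{d-1}, whose values at L have zero
    entries at distance d, so A_d = a r_d(L), with a nonzero because A_d is.
    The squared norm a^2 r_d(0) of the 0-1 matrix A_d is the average of its
    row sums a r_d(0), so a = 1. *)
Lemma sphere_top_card x : #|sphere e d x|%:R = (r ord_max).[0] :> R.
Proof.
have [_ _ norm_r] := r_predistance; set rd := r ord_max.
have rd_neq0 : rd.[0] != 0.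
  by rewrite gt_eqF // predistance_gt0.
have [f fA] := top_dist_mx_horner.
pose a := dot f rd / rd.[0].
have f_expand : A d = a *: mx_horner L rd.
  rewrite -fA predistance_expansion (bigD1 ord_max) //=.
  rewrite big1 ?addr0 // => k k_neq.
  rewrite (_ : dot f (r k) = 0) ?mul0r ?scale0r //.
  rewrite /laplacian_dot fA [\tr _]big1 ?mulr0 // => i _.
  rewrite mxE big1 // => j _; rewrite mxE.
  case: eqP => [ij|]; last by rewrite mul0r.
  rewrite laplacian_poly_local ?mulr0 // dist_sym // ij size_r.
  by rewrite ltn_neqAle -ltnS ltn_ord andbT.
have f0 i : #|sphere e d (enum_val i)|%:R = f.[0].
  by rewrite -sum_dist_mx -fA laplacian_poly_sum.
have f0_rd : f.[0] = a * rd.[0].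
  have i : 'I_#|X| := Ordinal (ltnW card_X).
  rewrite -(laplacian_poly_sum simple_e f i) fA f_expand.
  rewrite -(laplacian_poly_sum simple_e rd i).
  by rewrite mulr_sumr; apply: eq_bigr => j _; rewrite mxE.
have f_norm : dot f f = f.[0].
  rewrite /laplacian_dot fA mxtrace_sqr_symmetric ?dist_mx_sym //.
  rewrite (eq_bigr (fun=> f.[0])) => [|i _].
    by rewrite sumr_const card_ord -[f.[0] *+ _]mulr_natl mulKf.
  rewrite -(f0 i) -sum_dist_mx; apply: eq_bigr => j _; rewrite mxE.
  by case: eqP; rewrite ?expr1n ?expr0n.
have f_norm_rd : dot f f = a ^+ 2 * rd.[0].
  rewrite -norm_r /laplacian_dot fA f_expand -scalemxAl -scalemxAr !mxtraceZ.
  by rewrite expr2 -/rd; ring.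
have a_neq0 : a != 0.
  by apply: contraNneq top_dist_mx_neq0 => a0; rewrite f_expand a0 scale0r.
have a1 : a = 1.
  apply: (mulfI a_neq0); apply: (mulIf rd_neq0).
  by rewrite mulr1 -f0_rd -f_norm f_norm_rd expr2.
by rewrite -[x]enum_rankK f0 f0_rd a1 mul1r.
Qed.

End SpectralExcess.

End Predistance.

Theorem corollary3p2 (R : rcfType) (X : finType) (e : rel X)
    (simple_e : simple_graph e) (connected_e : connected_graph e)
    (card_X : (2 <= #|X|)%N)
    (d : nat) (theta : 'I_d.+1 -> R) (spec : laplacian_spectrum e theta)
    (r : 'I_d.+1 -> {poly R}) (r_predistance : laplacian_predistance e r) :
  let n : R := #|X|%:R in
  let psi := spectral_psi theta in
  let s : {poly R} := \sum_(i < d.+1 | (i < d)%N) r i in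
  distance_regular e <->
  diameter e = d /\
  [/\ n / (\sum_(x : X) (n - #|sphere e d x|%:R)^-1) = s.[0],
      s.[0] = n - (r ord_max).[0]
    & n - (r ord_max).[0] =
      n * (1 - (\sum_(i < d.+1) psi ord0 ^+ 2 /
                  ((multiplicity e (theta i))%:R * psi i ^+ 2))^-1)].
Proof.
move=> n psi s.
have s0 : s.[0] = n - (r ord_max).[0].
  exact: (predistance_below_top0 simple_e connected_e card_X spec r_predistance).
have n_neq0 : n != 0 by rewrite gt_eqF // natr_card_gt0.
split=> [reg|[_ [mean _ _]]]; last first.
  apply: (distance_regular_of_dist_mx simple_e connected_e card_X spec
            r_predistance).
  apply: (predistance_dist_mx simple_e connected_e card_X spec r_predistance).
  exact: (predistance_top_dist_mx simple_e connected_e card_X spec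
            r_predistance mean).
split.
  exact: (regular_diameter simple_e connected_e card_X spec r_predistance reg).
split=> //.
  have sphereE :=
    sphere_top_card simple_e connected_e card_X spec r_predistance reg.
  rewrite s0; under eq_bigr do rewrite sphereE.
  by rewrite sumr_const -mulr_natl invfM mulrA mulfV // mul1r invrK.
have := predistance_top0 simple_e connected_e card_X spec r_predistance.
rewrite -/n; set W := \sum_i _ => rdW.
have W_neq0 : W != 0 by apply: contraNneq n_neq0 => W0; rewrite -rdW W0 mulr0.
by rewrite -rdW; field.
Qed.
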